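(* Let $P$ and $Q$ be probability distributions on a finite set $\mathsf Z$. Then $$H_{\mathsf A,\ell}(P)-H_{\mathsf A,\ell}(Q)\le d_H(Q,P)+\|\nabla H_{\mathsf A,\ell}(P)\|\,\|P-Q\|,$$ where $d_H(Q,P)=H_{\mathsf A,\ell}(P)-H_{\mathsf A,\ell}(Q)+\nabla H_{\mathsf A,\ell}(P)^\top(Q-P)$. Moreover, $$H_{\mathsf A,\ell}(P)-H_{\mathsf A,\ell}(Q)\le\|\nabla H_{\mathsf A,\ell}(Q)\|\,\|P-Q\|.$$
   Context: $\mathsf A$ is a space of actions and $\ell:\mathsf Z\times\mathsf A\to\mathbb R$ a loss function. The generalized entropy of a distribution $P$ on $\mathsf Z$ is $H_{\mathsf A,\ell}(P)=\inf_{a\in\mathsf A}\mathbb E_P[\ell(Z,a)]$, $Z\sim P$; it is a concave function of $P$. Distributions on the finite set $\mathsf Z$ are identified with vectors in $\mathbb R^{|\mathsf Z|}$, and $\|\cdot\|$ is the Euclidean norm. $\nabla H_{\mathsf A,\ell}(P)$ denotes the gradient at $P$ of $H_{\mathsf A,\ell}$, regarded as a function (extended to a neighbourhood of $P$ in $\mathbb R^{|\mathsf Z|}$) of the vector $P$; it is assumed to exist at the points where it appears. In general, $d_H(P,Q)=H_{\mathsf A,\ell}(Q)-H_{\mathsf A,\ell}(P)+\nabla H_{\mathsf A,\ell}(Q)^\top(P-Q)$ is the Bregman divergence generated by the negative generalized entropy. *)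

(* Defs.v *)
From mathcomp Require Export all_boot all_order all_algebra.
From mathcomp Require Export all_classical all_reals all_analysis.

Set Implicit Arguments.
Unset Strict Implicit.
Unset Printing Implicit Defensive.

Import Order.TTheory GRing.Theory Num.Theory.
Export numFieldNormedType.Exports.

Local Open Scope classical_set_scope.
Local Open Scope ring_scope.

(* A vector p : 'rV[R]_#|Z| gives the point enum_val i of Z the mass p 0 i. *)
Definition is_distr (R : realType) (Z : finType) (p : 'rV[R]_#|Z|) : Prop :=
  (forall i, 0 <= p 0 i) /\ \sum_i p 0 i = 1.

Definition expect (R : realType) (Z : finType) (p : 'rV[R]_#|Z|) (f : Z -> R)
    : R :=
  \sum_i p 0 i * f (enum_val i).

(* Valued in \bar R: nothing prevents the infimum from being -oo (or +oo, if
   there is no action). *)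
Definition gen_entropy (R : realType) (Z : finType) (A : Type)
    (l : Z -> A -> R) (p : 'rV[R]_#|Z|) : \bar R :=
  ereal_inf (range (fun a : A => (expect p (l ^~ a))%:E)).

Definition dotv (R : realType) (n : nat) (u v : 'rV[R]_n) : R :=
  \sum_i u 0 i * v 0 i.

(* The library norm on 'rV[R]_n is the sup norm. *)
Definition enorm (R : realType) (n : nat) (u : 'rV[R]_n) : R :=
  Num.sqrt (dotv u u).

Definition gradient (R : realType) (n : nat) (F : 'rV[R]_n -> R)
    (p : 'rV[R]_n) : 'rV[R]_n :=
  \row_i 'D_(delta_mx 0 i) F p.

(* F extends the entropy, a priori defined only on distributions, to a
   neighbourhood of p: only the values of F near p matter. The extension is
   real-valued, so the entropy is finite at the distributions close to p. *)
Definition extends_entropy (R : realType) (Z : finType) (A : Type)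
    (l : Z -> A -> R) (p : 'rV[R]_#|Z|) (F : 'rV[R]_#|Z| -> R) : Prop :=
  \forall q \near p, is_distr q -> gen_entropy l q = (F q)%:E.

(* F is the extension of the entropy around q whose gradient at q is used. *)
Definition bregman (R : realType) (Z : finType) (A : Type)
    (l : Z -> A -> R) (F : 'rV[R]_#|Z| -> R) (p q : 'rV[R]_#|Z|) : \bar R :=
  (gen_entropy l q - gen_entropy l p + (dotv (gradient F q) (p - q))%:E)%E.

(* Main.v *)
(** Both inequalities are Cauchy-Schwarz once one knows that a concave function
    lies below its tangent hyperplane: the first needs no concavity, because
    the entropy terms on its two sides coincide; for the second, concavity
    along the segment from [Q] to [P] bounds every right difference quotient of
    the extension [F] at [Q] from below by [H(P) - H(Q)]. *)

Require Import Defs.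
From mathcomp Require Import ring lra.

Import Order.TTheory GRing.Theory Num.Theory.

Local Open Scope classical_set_scope.
Local Open Scope ring_scope.

Section EuclideanRowVectors.
Context {R : realType} {n : nat}.
Implicit Types (u v : 'rV[R]_n) (F : 'rV[R]_n -> R).

Lemma dotv_ge0 u : 0 <= dotv u u.
Proof. by apply: sumr_ge0 => i _; rewrite -expr2 sqr_ge0. Qed.

Lemma dotvNr u v : dotv u (- v) = - dotv u v.
Proof.
by rewrite /dotv -sumrN; apply: eq_bigr => i _; rewrite mxE mulrN.
Qed.

Lemma enorm_ge0 u : 0 <= enorm u.
Proof. exact: sqrtr_ge0. Qed.

Lemma enorm_sqr u : enorm u ^+ 2 = dotv u u.
Proof. by rewrite sqr_sqrtr ?dotv_ge0. Qed.

Lemma enorm_eq0 u : enorm u = 0 -> u = 0.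
Proof.
move=> u0; apply/rowP => i; rewrite mxE; apply/eqP.
have /eqP : dotv u u = 0 by rewrite -enorm_sqr u0 expr0n.
rewrite psumr_eq0 => [|j _]; last by rewrite -expr2 sqr_ge0.
by move=> /allP/(_ i (mem_index_enum _)); rewrite -expr2 sqrf_eq0.
Qed.

Lemma dotv_sub_scale (a b : R) u v :
  dotv (a *: u - b *: v) (a *: u - b *: v) =
  a ^+ 2 * dotv u u - (a * b * dotv u v) *+ 2 + b ^+ 2 * dotv v v.
Proof.
rewrite /dotv !mulr_sumr -sumrMnl -sumrB -big_split /=.
by apply: eq_bigr => i _; rewrite !mxE; ring.
Qed.

(** Cauchy-Schwarz: the square of [enorm v *: u - enorm u *: v] expands to twice [enorm u * enorm v
    * (enorm u * enorm v - dotv u v)]. Dividing by the product of the norms requires both to be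
    nonzero, hence the two cases treated first. *)
Lemma dotv_le_enorm u v : dotv u v <= enorm u * enorm v.
Proof.
have [/enorm_eq0 ->|u0] := eqVneq (enorm u) 0.
  rewrite [dotv _ _]big1 => [|i _]; last by rewrite mxE mul0r.
  by rewrite mulr_ge0 ?enorm_ge0.
have [/enorm_eq0 ->|v0] := eqVneq (enorm v) 0.
  rewrite [dotv _ _]big1 => [|i _]; last by rewrite mxE mulr0.
  by rewrite mulr_ge0 ?enorm_ge0.
have uv0 : 0 < enorm u * enorm v by rewrite mulr_gt0 // lt0r ?u0 ?v0 enorm_ge0.
rewrite -(ler_pM2l uv0).
have := dotv_ge0 (enorm v *: u - enorm u *: v).
rewrite dotv_sub_scale -!enorm_sqr; nra.
Qed.

(** [gradient] only records partial derivatives; linearity of the differential recovers every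
    direction from them. *)
Lemma derive_gradient F u v :
  differentiable F u -> 'D_v F u = dotv (gradient F u) v.
Proof.
move=> dF; rewrite deriveE // {1}(row_sum_delta v) linear_sum /dotv.
by apply: eq_bigr => i _; rewrite linearZ /= mxE deriveE // mulrC.
Qed.

(** One-sided because the segment from [q] towards [p] is known to stay among distributions only for
    [t >= 0]. The derivative is also the right limit of the difference quotients, and a lower bound
    on these passes to the limit. *)
Lemma derive_ge_right F u v (c : R) : differentiable F u ->
  (\forall t \near 0^'+, t * c <= F (t *: v + u) - F u) -> c <= 'D_v F u.
Proof.
move=> dF Fc.
have dFv : derivable F u v by exact: diff_derivable.
rewrite /derive cvg_at_rightE //.
apply: limr_ge; first exact: cvgP (cvg_dnbhs_at_right dFv).
near=> t.
have t0 : 0 < t by near: t; exact: nbhs_right_gt.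
rewrite /= -(ler_pM2l t0) /GRing.scale /= mulVKf ?gt_eqF //.
by near: t.
Unshelve. all: by end_near. Qed.

End EuclideanRowVectors.

Section Entropy.
Context {R : realType} {Z : finType} {A : Type}.
Variable l : Z -> A -> R.
Implicit Types (p q : 'rV[R]_#|Z|) (F : 'rV[R]_#|Z| -> R).

Lemma is_distr_segment p q (t : R) : 0 <= t <= 1 ->
  is_distr p -> is_distr q -> is_distr (t *: (p - q) + q).
Proof.
move=> /andP[t0 t1] [p0 p1] [q0 q1]; split=> [i|].
  by rewrite !mxE; have := p0 i; have := q0 i; nra.
under eq_bigr do rewrite !mxE.
by rewrite big_split /= -mulr_sumr sumrB p1 q1 subrr mulr0 add0r.
Qed.

Lemma expect_segment p q (t : R) (f : Z -> R) :
  expect (t *: (p - q) + q) f = t * (expect p f - expect q f) + expect q f.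
Proof.
rewrite /expect -sumrB mulr_sumr -big_split /=.
by apply: eq_bigr => i _; rewrite !mxE; ring.
Qed.

Lemma le_gen_entropyP p (c : R) :
  (c%:E <= gen_entropy l p)%E <-> forall a, c <= expect p (l ^~ a).
Proof.
split=> [cp a|cp].
  by rewrite -lee_fin; apply: le_trans cp _; apply: ereal_inf_lbound; exists a.
by apply: le_ereal_inf_tmp => _ [a _ <-]; rewrite lee_fin.
Qed.

(** Each expected loss is affine along the segment, and an infimum of affine functions is concave.
    Real lower bounds [c] and [d] stand for the two entropies, which avoids arithmetic with
    infinities. *)
Lemma gen_entropy_concave p q (c d t : R) : 0 <= t <= 1 ->
  (c%:E <= gen_entropy l p)%E -> (d%:E <= gen_entropy l q)%E ->
  ((t * (c - d) + d)%:E <= gen_entropy l (t *: (p - q) + q)%R)%E.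
Proof.
move=> /andP[t0 t1] /le_gen_entropyP cp /le_gen_entropyP dq.
apply/le_gen_entropyP => a; rewrite expect_segment.
by have := cp a; have := dq a; nra.
Qed.

Lemma extends_entropy_at p F :
  is_distr p -> extends_entropy l p F -> gen_entropy l p = (F p)%:E.
Proof. by move=> dp /nbhs_singleton; apply. Qed.

Lemma extends_entropy_segment p q F : is_distr p -> is_distr q ->
  extends_entropy l q F ->
  \forall t \near 0^'+,
    gen_entropy l (t *: (p - q) + q) = (F (t *: (p - q) + q))%:E.
Proof.
move=> dp dq qF.
(* Pulls the neighbourhood of [q] on which [F] extends the entropy back to small [t > 0]. *)
have cvgq : t *: (p - q) + q @[t --> (0 : R)^'+] --> q.
  apply: cvg_at_right_filter; rewrite -[X in _ --> X]add0r -(scale0r (p - q)).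
  by apply: cvgD; [apply: cvgZr_tmp; exact: cvg_id | exact: cvg_cst].
have {}qF := cvgq _ qF.
near=> t.
suff : is_distr (t *: (p - q) + q) by near: t; exact: qF.
apply: is_distr_segment => //; apply/andP; split.
  by near: t; exact: nbhs_right_ge.
by near: t; exact: nbhs_right_le.
Unshelve. all: by end_near. Qed.

Lemma gen_entropy_le_tangent p q F : is_distr p -> is_distr q ->
  extends_entropy l q F -> differentiable F q ->
  (gen_entropy l p <= (F q + dotv (gradient F q) (p - q))%:E)%E.
Proof.
move=> dp dq qF dF.
(* The entropy at [p] may be infinite, so the tangent bound is first shown for its real lower
   bounds. *)
have tangent (c : R) : (c%:E <= gen_entropy l p)%E ->
    c <= F q + dotv (gradient F q) (p - q).
  move=> cp; rewrite -lerBlDl -derive_gradient //.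
  apply: derive_ge_right => //; near=> t.
  have t01 : 0 <= t <= 1.
    by apply/andP; split; near: t; [exact: nbhs_right_ge|exact: nbhs_right_le].
  rewrite lerBrDr -lee_fin.
  have <- : gen_entropy l (t *: (p - q) + q) = (F (t *: (p - q) + q))%:E.
    by near: t; exact: extends_entropy_segment.
  by apply: gen_entropy_concave => //; rewrite (extends_entropy_at _ _ dq qF).
case: (gen_entropy l p) tangent => [r| |] tangent; last exact: leNye.
  by rewrite lee_fin; exact: tangent.
(* The value [+oo] is impossible: every real would be a lower bound, even the tangent value plus
   1. *)
have := tangent (F q + dotv (gradient F q) (p - q) + 1).
by rewrite gerDl ler10 => /(_ (leey _)).
Unshelve. all: by end_near. Qed.

End Entropy.

Theorem theorem8 (R : realType) (Z : finType) (A : Type) (l : Z -> A -> R)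
    (P Q : 'rV[R]_#|Z|) (hP : is_distr P) (hQ : is_distr Q) :
  (forall F : 'rV[R]_#|Z| -> R,
     extends_entropy l P F -> differentiable F P ->
     (gen_entropy l P - gen_entropy l Q
        <= bregman l F Q P + (enorm (gradient F P) * enorm (P - Q))%:E)%E) /\
  (forall F : 'rV[R]_#|Z| -> R,
     extends_entropy l Q F -> differentiable F Q ->
     (gen_entropy l P - gen_entropy l Q
        <= (enorm (gradient F Q) * enorm (P - Q))%:E)%E).
Proof.
split=> F extF dF.
  (* The entropy difference, finite or not, is common to both sides; only the nonnegativity of the
     real remainder is left. *)
  rewrite /bregman -addeA -EFinD leeDl // lee_fin -opprB dotvNr.
  by rewrite addrC subr_ge0 dotv_le_enorm.
(* The entropy at [Q] is the real [F Q], so it can be moved across the inequality. *)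
rewrite (extends_entropy_at _ _ _ hQ extF) leeBlDr //.
apply: le_trans (gen_entropy_le_tangent _ _ _ _ hP hQ extF dF) _.
by rewrite -EFinD lee_fin addrC lerD2r dotv_le_enorm.
Qed.
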